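(* Let $m<n$ be positive integers, $A\in\mathbb{C}^{m\times n}$, $b\in\mathbb{C}^m$ such that the linear system $Ax=b$ has a solution, and $\delta>0$. Let $\tau,\gamma>0$ satisfy $\tau\lambda_{\max}+\gamma<2$, where $\lambda_{\max}$ denotes the maximum eigenvalue of $A^*A$. Let $\beta>0$ be fixed. For an arbitrary starting point $(x^0,y^0)\in\mathbb{C}^n\times\mathbb{C}^m$, let the sequence $\{(r^k,x^k,y^k)\}$ be generated, for $k=0,1,2,\dots$, by $$r^{k+1}=\mathcal{P}_{B_\delta}\left(y^k/\beta-(Ax^k-b)\right),$$ $$x^{k+1}=\mathrm{Shrink}\left(x^k-\tau g^k,\ \frac{\tau}{\beta}\right),\qquad g^k:=A^*\left(Ax^k+r^{k+1}-b-y^k/\beta\right),$$ $$y^{k+1}=y^k-\gamma\beta\left(Ax^{k+1}+r^{k+1}-b\right).$$ Then $\{(r^k,x^k,y^k)\}$ converges to some $(\tilde r,\tilde x,\tilde y)\in\mathbb{C}^m\times\mathbb{C}^n\times\mathbb{C}^m$, where $(\tilde r,\tilde x)$ solves $$\min_{x\in\mathbb{C}^n,\ r\in\mathbb{C}^m}\left\{\|x\|_1:\ Ax+r=b,\ \|r\|\le\delta\right\}.$$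
   Context: $\|\cdot\|$ is the Euclidean ($\ell_2$) norm, $\|x\|_1=\sum_i|x_i|$ with $|\cdot|$ the complex modulus, and $A^*$ is the conjugate transpose of $A$. $\mathcal{P}_{B_\delta}$ is the Euclidean projection onto the ball $B_\delta=\{\xi\in\mathbb{C}^m:\|\xi\|\le\delta\}$. For $v\in\mathbb{C}^n$ and $t>0$, the shrinkage (soft-thresholding) operator is defined componentwise by $\mathrm{Shrink}(v,t)_i=\max\{|v_i|-t,0\}\,\mathrm{sign}(v_i)$, where $\mathrm{sign}(z)=z/|z|$ for $z\neq 0$ and $\mathrm{sign}(0)=0$. The sequence is indexed by $k\ge 1$ (the iteration needs no initial $r^0$). *)

(* Defs.v *)
From HB Require Import structures.
From mathcomp Require Export all_boot all_order all_algebra.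
From mathcomp Require Export complex.
From mathcomp Require Export all_classical all_reals all_analysis.

Set Implicit Arguments.
Unset Strict Implicit.
Unset Printing Implicit Defensive.

Export Order.TTheory GRing.Theory Num.Theory.
Export numFieldNormedType.Exports.

Local Open Scope classical_set_scope.
Local Open Scope ring_scope.
Local Open Scope complex_scope.

(* The modulus [`|z|] of z : R[i] lives in R[i]; [cmod z] is the same number
   as an element of R (see [cmodE]). *)
Definition cmod (R : realType) (z : R[i]) : R :=
  Num.sqrt (complex.Re z ^+ 2 + complex.Im z ^+ 2).

Lemma cmodE (R : realType) (z : R[i]) : (cmod z)%:C = `|z|.
Proof. by rewrite normc_def. Qed.

Definition l2norm (R : realType) (n : nat) (v : 'cV[R[i]]_n) : R :=
  Num.sqrt (\sum_(i < n) cmod (v i 0) ^+ 2).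

Definition l1norm (R : realType) (n : nat) (v : 'cV[R[i]]_n) : R :=
  \sum_(i < n) cmod (v i 0).

Definition l2ball (R : realType) (m : nat) (delta : R) : set 'cV[R[i]]_m :=
  [set xi | l2norm xi <= delta].

Definition is_nearest (R : realType) (m : nat) (S : set 'cV[R[i]]_m)
    (v p : 'cV[R[i]]_m) : Prop :=
  S p /\ forall q, S q -> l2norm (v - p) <= l2norm (v - q).

(* The default value 0 is returned only if v has no nearest point in S, which
   does not happen when S is nonempty and closed. *)
Definition euclid_proj (R : realType) (m : nat) (S : set 'cV[R[i]]_m)
    (v : 'cV[R[i]]_m) : 'cV[R[i]]_m :=
  xget 0 [set p | is_nearest S v p].

(* [Num.sg] is not z / |z| on non-real complex numbers. *)
Definition csign (R : realType) (z : R[i]) : R[i] :=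
  if z == 0 then 0 else z / `|z|.

Definition shrink (R : realType) (n : nat) (v : 'cV[R[i]]_n) (t : R) :
    'cV[R[i]]_n :=
  \col_i ((Num.max (cmod (v i 0) - t) 0)%:C * csign (v i 0)).

(* On R[i], [a <= l%:C] forces a to be real. For Hermitian M this is no
   restriction. *)
Definition is_max_eigenvalue (R : realType) (n : nat) (M : 'M[R[i]]_n)
    (l : R) : Prop :=
  eigenvalue M l%:C /\ forall a : R[i], eigenvalue M a -> a <= l%:C.

Definition bp_feasible (R : realType) (m n : nat) (A : 'M[R[i]]_(m, n))
    (b : 'cV[R[i]]_m) (delta : R) (r : 'cV[R[i]]_m) (x : 'cV[R[i]]_n) : Prop :=
  A *m x + r = b /\ l2norm r <= delta.

Definition bp_solution (R : realType) (m n : nat) (A : 'M[R[i]]_(m, n))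
    (b : 'cV[R[i]]_m) (delta : R) (r : 'cV[R[i]]_m) (x : 'cV[R[i]]_n) : Prop :=
  bp_feasible A b delta r x /\
  forall r' x', bp_feasible A b delta r' x' -> l1norm x <= l1norm x'.

Definition l2cvg (R : realType) (n : nat) (u : nat -> 'cV[R[i]]_n)
    (l : 'cV[R[i]]_n) : Prop :=
  l2norm (u k - l) @[k --> \oo] --> (0 : R).

(* Main.v *)
(** The iteration is analysed through a saddle point (r~, x~, y~) of the
    Lagrangian [|x|_1 - Re <y, A x + r - b>].  The variational inequalities of
    the projection and of the shrinkage, tested at the saddle point, show that
    [(beta / tau) |x - x~|^2 + (gamma beta)^-1 |y - y~|^2] decreases at each
    step by at least a positive multiple of [|x' - x|^2 + |A x' + r' - b|^2]:
    the cross term [<A (x' - x), A x' + r' - b>] is absorbed by Young's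
    inequality because [tau lmax < 2 - gamma].  Hence these increments tend to
    0, every limit point of the iterates is again a saddle point, and the
    monotone distance to that one tends to 0.

    A saddle point exists because b is in the range of A: minimizers of
    [|x|_1 + |A x + r - b|^2 / (2 e)] over the ball have scaled residuals that
    stay bounded as [e] tends to 0 (test with a solution of [A x0 = b] and a
    point of the sphere).

    Limit points are taken along a fixed ultrafilter finer than [\oo], so that
    all bounded sequences converge simultaneously without extraction. *)

From HB Require Import structures.
Require Import Defs.
From mathcomp Require Import ring lra.

Set Implicit Arguments.
Unset Strict Implicit.
Unset Printing Implicit Defensive.

Local Open Scope classical_set_scope.
Local Open Scope ring_scope.
Local Open Scope complex_scope.
Local Open Scope sesquilinear_scope.

(** * The real inner product *)

(** Multiplied by [z], either conjugate gives [|z|^2], and a nonzero [z] can be cancelled. *)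
Lemma conjC_conjc (R : realType) (z : R[i]) : Num.conj z = conjc z.
Proof.
have [->|z0] := eqVneq z 0; first by rewrite rmorph0 conjc0.
by apply: (mulfI z0); rewrite -normCK sqr_normc.
Qed.

(* Locked: [ring] and [lra] compare their atoms up to conversion. *)
HB.lock Definition ip (R : realType) (n : nat) (u v : 'cV[R[i]]_n) : R :=
  complex.Re ((v ^t* *m u) 0 0).
Arguments ip {R n} u v.

Section InnerProduct.
Variables (R : realType) (n : nat).
Implicit Types (u v w : 'cV[R[i]]_n) (c : R).

Lemma ipE u v : ip u v =
  \sum_i (complex.Re (u i 0) * complex.Re (v i 0)
          + complex.Im (u i 0) * complex.Im (v i 0)).
Proof.
rewrite ip.unlock mxE (raddf_sum (@complex.Re R)).
apply: eq_bigr => i _; rewrite !mxE conjC_conjc.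
by case: (u i 0) (v i 0) => [a b] [c d] /=; ring.
Qed.

Lemma ipC u v : ip u v = ip v u.
Proof. by rewrite !ipE; apply: eq_bigr => i _; ring. Qed.

Lemma ipDl u v w : ip (u + v) w = ip u w + ip v w.
Proof. by rewrite ip.unlock mulmxDr mxE raddfD. Qed.

Lemma ipNl u w : ip (- u) w = - ip u w.
Proof. by rewrite ip.unlock mulmxN mxE raddfN. Qed.

Lemma ipZl c u w : ip (c%:C *: u) w = c * ip u w.
Proof.
rewrite ip.unlock -scalemxAr mxE; case: (_ 0 0) => a b /=; ring.
Qed.

Lemma ip0l w : ip 0 w = 0.
Proof. by rewrite ip.unlock mulmx0 mxE. Qed.

Lemma ipDr u v w : ip w (u + v) = ip w u + ip w v.
Proof. by rewrite ![ip w _]ipC ipDl. Qed.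

Lemma ipNr u w : ip w (- u) = - ip w u.
Proof. by rewrite ![ip w _]ipC ipNl. Qed.

Lemma ipZr c u w : ip w (c%:C *: u) = c * ip w u.
Proof. by rewrite ![ip w _]ipC ipZl. Qed.

Lemma ip0r w : ip w 0 = 0.
Proof. by rewrite ipC ip0l. Qed.

Definition ip_lin := (ipDl, ipDr, ipNl, ipNr, ipZl, ipZr).

Lemma ip_sq u : ip u u = \sum_i cmod (u i 0) ^+ 2.
Proof.
rewrite ipE; apply: eq_bigr => i _.
by rewrite sqr_sqrtr ?addr_ge0 ?sqr_ge0// !expr2.
Qed.

Lemma ip_ge0 u : 0 <= ip u u.
Proof. by rewrite ip_sq sumr_ge0// => i _; rewrite sqr_ge0. Qed.

Lemma l2normE u : l2norm u = Num.sqrt (ip u u).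
Proof. by rewrite ip_sq. Qed.

Lemma l2norm_le u c : 0 <= c -> (l2norm u <= c) = (ip u u <= c ^+ 2).
Proof.
move=> c0; rewrite l2normE -(ler_sqr (sqrtr_ge0 _) c0).
by rewrite sqr_sqrtr ?ip_ge0.
Qed.

Lemma cmod_le_ip u i : cmod (u i 0) ^+ 2 <= ip u u.
Proof.
rewrite ip_sq (bigD1 i)//= lerDl sumr_ge0// => j _; exact: sqr_ge0.
Qed.

Lemma cmod_le_l1 u i : cmod (u i 0) <= l1norm u.
Proof.
rewrite /l1norm (bigD1 i)//= lerDl sumr_ge0// => j _; exact: sqrtr_ge0.
Qed.

Lemma cmod_ge0 (z : R[i]) : 0 <= cmod z.
Proof. exact: sqrtr_ge0. Qed.

Lemma l1norm_ge0 u : 0 <= l1norm u.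
Proof. by rewrite sumr_ge0// => i _; exact: cmod_ge0. Qed.

Lemma cmod_sq (z : R[i]) :
  cmod z ^+ 2 = complex.Re z ^+ 2 + complex.Im z ^+ 2.
Proof. by rewrite sqr_sqrtr// addr_ge0 ?sqr_ge0. Qed.

Lemma cmod_eq0 (z : R[i]) : (cmod z == 0) = (z == 0).
Proof. by rewrite -(inj_eq (@complexI R)) cmodE normr_eq0. Qed.

Lemma ip_eq0 u : ip u u = 0 -> u = 0.
Proof.
move=> u0; apply/matrixP => i j; rewrite ord1 mxE.
apply/eqP; rewrite -cmod_eq0 -sqrf_eq0 eq_le sqr_ge0 andbT.
by rewrite -u0 cmod_le_ip.
Qed.

Lemma cmodM (z w : R[i]) : cmod (z * w) = cmod z * cmod w.
Proof. by apply: (@complexI R); rewrite rmorphM/= !cmodE normrM. Qed.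

Lemma cmodD (z w : R[i]) : cmod (z + w) <= cmod z + cmod w.
Proof. by rewrite -lecR rmorphD/= !cmodE ler_normD. Qed.

Lemma cmodR (c : R) : cmod c%:C = `|c|.
Proof. by rewrite /cmod/= expr0n addr0 sqrtr_sqr. Qed.

Lemma l1norm_convex u v c : 0 <= c -> c <= 1 ->
  l1norm (u + c%:C *: (v - u)) <= l1norm u + c * (l1norm v - l1norm u).
Proof.
move=> c0 c1; rewrite /l1norm -sumrB mulr_sumr -big_split/=.
apply: ler_sum => i _; rewrite !mxE.
have -> : u i 0 + c%:C * (v i 0 - u i 0)
    = (1 - c)%:C * u i 0 + c%:C * v i 0.
  by rewrite rmorphB rmorph1; ring.
apply: le_trans (cmodD _ _) _; rewrite !cmodM !cmodR !ger0_norm ?subr_ge0//.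
by rewrite le_eqVlt; apply/orP; left; apply/eqP; ring.
Qed.

(** The right side exceeds the left one by [c (1 - c) |v - u|^2]. *)
Lemma ip_convex u v c : 0 <= c -> c <= 1 ->
  ip (u + c%:C *: (v - u)) (u + c%:C *: (v - u)) <=
  ip u u + c * (ip v v - ip u u).
Proof.
move=> c0 c1; have := mulr_ge0 (mulr_ge0 c0 (_ : 0 <= 1 - c)) (ip_ge0 (v - u)).
rewrite subr_ge0 => /(_ c1); rewrite !ip_lin (ipC v u); nra.
Qed.

End InnerProduct.

(** * Adjoints and the Rayleigh bound *)

Lemma ip_mulmxl (R : realType) (m n : nat) (A : 'M[R[i]]_(m, n)) u v :
  ip (A *m u) v = ip u (A ^t* *m v).
Proof. by rewrite ip.unlock trmx_mul map_mxM trmxCK mulmxA. Qed.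

Lemma ip_mulmxr (R : realType) (m n : nat) (A : 'M[R[i]]_(m, n)) u v :
  ip v (A *m u) = ip (A ^t* *m v) u.
Proof. by rewrite ipC ip_mulmxl ipC. Qed.

(** In a unitary diagonalization of [A^*A] both sides are weighted sums of the [|w_i|^2]: the
    weights are the eigenvalues on the left and [l] on the right. *)
Lemma rayleigh_le (R : realType) (m n : nat) (A : 'M[R[i]]_(m, n)) (l : R) u :
  is_max_eigenvalue (A ^t* *m A) l -> ip (A *m u) (A *m u) <= l * ip u u.
Proof.
move=> [_ lmax]; rewrite ip_mulmxl mulmxA; set M := _ *m A in lmax *.
have herM : M \is hermsymmx.
  by apply/is_hermitianmxP; rewrite expr0 scale1r trmx_mul map_mxM trmxCK.
have /orthomx_spectralP := hermitian_normalmx herM.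
set P := spectralmx M; set d := spectral_diag M => ME.
have uP : P \is unitarymx by exact: spectral_unitarymx.
have Pu : P \in unitmx by exact: spectral_unit.
have PM : P *m M = diag_mx d *m P by rewrite ME !mulmxA mulmxV// mul1mx.
(* [eigenvalue] refers to left eigenvectors, so row [i] of [P] serves; it is nonzero because [P] is
   invertible. *)
have dl i : d 0 i <= l%:C.
  apply: lmax; apply/eigenvalueP; exists (row i P).
    rewrite -row_mul PM; apply/rowP => j; rewrite !mxE (bigD1 i)//= big1.
      by rewrite !mxE eqxx mulr1n addr0.
    by move=> k ki; rewrite !mxE eq_sym (negbTE ki) mulr0n mul0r.
  apply/eqP => Pi0; move: Pu; rewrite -row_free_unit => /row_freeP[Q PQ].
  have := congr1 (fun X => row i X 0 i) PQ.
  rewrite row_mul Pi0 mul0mx !mxE eqxx; apply/eqP.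
  by rewrite eq_sym oner_eq0.
have -> : M *m u = P ^t* *m (diag_mx d *m (P *m u)).
  by rewrite {1}ME (invmx_unitary uP) -!mulmxA.
have -> : ip u u = ip (P *m u) (P *m u).
  rewrite ip_mulmxl mulmxA.
  by rewrite -(invmx_unitary uP) mulVmx// mul1mx.
rewrite ip_mulmxr trmxCK; set w := P *m u.
rewrite !ipE mulr_sumr; apply: ler_sum => i _.
have -> : (diag_mx d *m w) i 0 = d 0 i * w i 0.
  rewrite !mxE (bigD1 i)//= big1 => [|k ki].
    by rewrite !mxE eqxx mulr1n addr0.
  by rewrite !mxE eq_sym (negbTE ki) mulr0n mul0r.
move: (dl i); case: (d 0 i) (w i 0) => a b [p q].
(* The order on [R[i]] also forces the diagonal entry to be real. *)
by rewrite lecE /= => /andP[/eqP<- al]; nra.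
Qed.

(** * Projection and shrinkage *)

(** Replaces the limit [t -> 0] that turns minimality along a segment into a first-order
    inequality. *)
Lemma ge0_of_small_slope (R : realFieldType) (a c : R) :
  (forall t, 0 < t -> t <= 1 -> 0 <= a + t * c) -> 0 <= a.
Proof.
move=> H; rewrite leNgt; apply/negP => a0.
have d0 : 0 < 2 * (`|c| - a) by have := normr_ge0 c; lra.
(* For [a < 0] this value of [t] gives [a + t |c| = a / 2 + t a < 0]. *)
have t0 : 0 < - a / (2 * (`|c| - a)) by rewrite divr_gt0// oppr_gt0.
have t1 : - a / (2 * (`|c| - a)) <= 1.
  by rewrite ler_pdivrMr//; have := normr_ge0 c; lra.
have := H _ t0 t1.
set t := _ / _ in t0 t1 *.
have tE : t * (2 * (`|c| - a)) = - a by rewrite /t divfK// gt_eqF.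
have := ler_norm c; nra.
Qed.

Section Projection.
Variables (R : realType) (m : nat) (delta : R).
Hypothesis delta0 : 0 <= delta.
Implicit Types v p q : 'cV[R[i]]_m.

Lemma l2ballP p : l2ball delta p <-> ip p p <= delta ^+ 2.
Proof. by rewrite /l2ball/= l2norm_le. Qed.

Lemma l2ball_convex p q t : l2ball delta p -> l2ball delta q ->
  0 <= t -> t <= 1 -> l2ball delta (p + t%:C *: (q - p)).
Proof.
move=> /l2ballP bp /l2ballP bq t0 t1; apply/l2ballP.
by apply: le_trans (ip_convex p q t0 t1) _; nra.
Qed.

(** A point of the ball is its own nearest point; any other point is rescaled to norm [delta]. *)
Lemma l2ball_nearest_exists v : exists p, is_nearest (@l2ball R m delta) v p.
Proof.
have [bv|] := leP (l2norm v) delta.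
  exists v; split=> // q _; rewrite subrr l2normE ip0l sqrtr0.
  exact: sqrtr_ge0.
set s := l2norm v => ds; have s0 : 0 < s by exact: le_lt_trans ds.
have sE : ip v v = s ^+ 2 by rewrite /s l2normE sqr_sqrtr ?ip_ge0.
pose w := s^-1%:C *: v.
have w1 : ip w w = 1.
  by rewrite /w !ip_lin sE; field; rewrite gt_eqF.
have vE : v = s%:C *: w.
  by rewrite /w scalerA -rmorphM/= mulfV ?gt_eqF// scale1r.
clearbody w; exists (delta%:C *: w); split.
  by apply/l2ballP; rewrite !ip_lin w1 mulr1 expr2.
move=> q /l2ballP bq; rewrite !l2normE ler_wsqrtr//.
have := ip_ge0 (q - delta%:C *: w).
rewrite vE !ip_lin w1 (ipC q w) => h.
(* Cauchy-Schwarz against the unit vector [w], up to the factor [delta]; cancelling it requires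
   treating the ball of radius 0 separately. *)
have h2 : delta * ip w q <= delta ^+ 2 by nra.
have h3 : ip w q <= delta.
  have [d0|d0] := eqVneq delta 0; last first.
    by move: h2; rewrite expr2 ler_pM2l// lt0r d0.
  suff -> : q = 0 by rewrite ip0r.
  apply: ip_eq0; apply/eqP; rewrite eq_le ip_ge0 andbT.
  by move: bq; rewrite d0 expr0n.
(* The squared distances differ by the quantity in [h] plus [2 (s - delta) (delta - <w, q>)]. *)
nra.
Qed.

(** The obtuse-angle property: a short move from [p] towards [q] stays in the ball, hence cannot
    come closer to [v]. *)
Lemma euclid_projP v : let p := euclid_proj (@l2ball R m delta) v in
  l2ball delta p /\ forall q, l2ball delta q -> ip (v - p) (q - p) <= 0.
Proof.
move=> p; have [bp near] : is_nearest (@l2ball R m delta) v p.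
  exact: (xgetPex 0 (l2ball_nearest_exists v)).
split=> // q bq.
suff : 0 <= 2 * - ip (v - p) (q - p) by lra.
apply: (@ge0_of_small_slope R _ (ip (q - p) (q - p))) => t t0 t1.
have := near _ (l2ball_convex bp bq (ltW t0) t1).
rewrite !l2normE ler_sqrt ?ip_ge0// opprD addrA.
move: (v - p) (q - p) => a d.
rewrite !ip_lin (ipC d a) => h.
rewrite -(pmulr_rge0 _ t0); nra.
Qed.

End Projection.

(** * Shrinkage as a proximal map *)

Lemma plane_cauchy_schwarz (R : realType) (a b c d : R) :
  a * c + b * d <= Num.sqrt (a ^+ 2 + b ^+ 2) * Num.sqrt (c ^+ 2 + d ^+ 2).
Proof.
rewrite -sqrtrM ?addr_ge0 ?sqr_ge0//; apply: le_trans (ler_norm _) _.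
rewrite -sqrtr_sqr ler_wsqrtr//.
(* Lagrange's identity: this square is the difference of the two squared sides. *)
have := sqr_ge0 (a * d - b * c); nra.
Qed.

(** Expresses that [w - p] is a subgradient of [t |.|] at [p]. Below the threshold [p = 0] and this
    is Cauchy-Schwarz. *)
Lemma cshrink_le (R : realType) (w z p : R[i]) (t : R) : 0 <= t ->
  p = (Num.max (cmod w - t) 0)%:C * csign w ->
  complex.Re (w - p) * complex.Re (z - p)
    + complex.Im (w - p) * complex.Im (z - p) <= t * (cmod z - cmod p).
Proof.
move=> t0 pE0.
have CS : complex.Re w * complex.Re z + complex.Im w * complex.Im z
    <= cmod w * cmod z by exact: plane_cauchy_schwarz.
have z0 := cmod_ge0 z.
have [wt|tw] := leP (cmod w) t.
  have -> : p = 0 by rewrite pE0 max_r ?subr_le0// mul0r.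
  rewrite !subr0 /cmod/= !expr0n addr0 sqrtr0 subr0 -!/(cmod _).
  by apply: le_trans CS _; rewrite ler_wpM2r.
have w0 : 0 < cmod w by exact: le_lt_trans tw.
(* Above the threshold, shrinkage multiplies by [a = 1 - t / |w|], so [w - p = (1 - a) w] has
   modulus [t]. *)
pose a := (cmod w - t) / cmod w.
have a0 : 0 <= a by rewrite divr_ge0 ?subr_ge0// ltW.
have aE : a * cmod w = cmod w - t by rewrite divfK// gt_eqF.
have pE : p = a%:C * w.
  rewrite pE0 max_l ?subr_ge0 ?(ltW tw)// /csign -cmod_eq0 gt_eqF//.
  by rewrite -cmodE /a rmorphM/= fmorphV/=; ring.
rewrite pE cmodM cmodR ger0_norm//.
have a1 : (1 - a) * cmod w = t by rewrite mulrBl mul1r aE; ring.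
have a1_ge0 : 0 <= 1 - a by rewrite -(pmulr_lge0 _ w0) a1.
rewrite -a1; have /(congr1 (fun s => (1 - a) * a * s)) WE := cmod_sq w.
have := ler_wpM2l a1_ge0 CS.
move: (cmod w) (cmod z) WE => W Z.
case: w z {CS p pE0 pE z0 tw w0 aE a1} a a0 a1_ge0 => [x y] [u v] a _ _ /= WE.
lra.
Qed.

Lemma shrinkP (R : realType) (n : nat) (v z : 'cV[R[i]]_n) (t : R) : 0 <= t ->
  ip (v - shrink v t) (z - shrink v t)
    <= t * (l1norm z - l1norm (shrink v t)).
Proof.
move=> t0; rewrite ipE /l1norm -sumrB mulr_sumr; apply: ler_sum => i _.
have E w : (w - shrink v t) i 0 = w i 0 - shrink v t i 0 by rewrite !mxE.
by rewrite !E; apply: cshrink_le => //; rewrite mxE.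
Qed.

(** * Limits along filters *)

(** The values lie in a compact segment, hence have a cluster point, and a cluster point of an
    ultrafilter is a limit. *)
Lemma ultra_bounded_cvg (R : realType) (T : Type) (F : set_system T)
    (f : T -> R) (M : R) :
  UltraFilter F -> (forall k, `|f k| <= M) ->
  exists l : R, f k @[k --> F] --> l.
Proof.
move=> UF fM.
have := @segment_compact R (- M) M (f @ F) _.
case=> [|p [_ clp]].
  rewrite /fmap/=; apply: filterE => k; rewrite /= in_itv/= -ler_norml.
  exact: fM.
exists p => B nB; have [//|nFB] := in_ultra_setVsetC (f @^-1` B) UF.
by have [x [/= nBx]] := clp (~` B) B nFB nB.
Qed.

(** Taken by real and imaginary coordinates, so that limit theorems for real functions apply along
    any filter. *)
Definition cvgv (R : realType) (n : nat) (T : Type) (F : set_system T)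
    (u : T -> 'cV[R[i]]_n) (l : 'cV[R[i]]_n) : Prop :=
  forall i, complex.Re (u k i 0) @[k --> F] --> complex.Re (l i 0) /\
            complex.Im (u k i 0) @[k --> F] --> complex.Im (l i 0).

Section VectorLimits.
Variables (R : realType) (T : Type) (F : set_system T).
Hypothesis FF : ProperFilter F.

Lemma cvgr_sum (I : finType) (f : I -> T -> R) (l : I -> R) :
  (forall i, f i k @[k --> F] --> l i) ->
  \sum_i f i k @[k --> F] --> \sum_i l i.
Proof.
move=> fl; apply: cvg_big => // -[x y].
by apply: cvgD; [exact: cvg_fst|exact: cvg_snd].
Qed.

Lemma cvgv_mulmx m n (A : 'M[R[i]]_(m, n)) u a : cvgv F u a ->
  cvgv F (fun k => A *m u k) (A *m a).
Proof.
move=> ua i.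
have E w : complex.Re ((A *m w) i 0) = \sum_j (complex.Re (A i j)
    * complex.Re (w j 0) - complex.Im (A i j) * complex.Im (w j 0)).
  rewrite mxE raddf_sum; apply: eq_bigr => j _.
  by case: (A i j) (w j 0) => [? ?] [].
have E' w : complex.Im ((A *m w) i 0) = \sum_j (complex.Re (A i j)
    * complex.Im (w j 0) + complex.Im (A i j) * complex.Re (w j 0)).
  rewrite mxE (raddf_sum (@complex.Im R)); apply: eq_bigr => j _.
  by case: (A i j) (w j 0) => [? ?] [].
rewrite E E'; split.
  under eq_fun do rewrite E; apply: cvgr_sum => j.
  by have [? ?] := ua j; apply: cvgB; exact: cvgMl_tmp.
under eq_fun do rewrite E'; apply: cvgr_sum => j.
by have [? ?] := ua j; apply: cvgD; exact: cvgMl_tmp.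
Qed.

Section Dim.
Variable n : nat.
Implicit Types (u v : T -> 'cV[R[i]]_n).

Lemma cvgv_cst (a : 'cV[R[i]]_n) : cvgv F (fun=> a) a.
Proof. by move=> i; split; exact: cvg_cst. Qed.

Lemma cvgvD u v a b : cvgv F u a -> cvgv F v b ->
  cvgv F (fun k => u k + v k) (a + b).
Proof.
move=> ua vb i; have [ua1 ua2] := ua i; have [vb1 vb2] := vb i.
rewrite !mxE !raddfD; split.
  by under eq_fun do rewrite mxE raddfD; exact: cvgD.
by under eq_fun do rewrite mxE raddfD; exact: cvgD.
Qed.

Lemma cvgvN u a : cvgv F u a -> cvgv F (fun k => - u k) (- a).
Proof.
move=> ua i; have [ua1 ua2] := ua i.
rewrite !mxE !raddfN; split.
  by under eq_fun do rewrite mxE raddfN; exact: cvgN.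
by under eq_fun do rewrite mxE raddfN; exact: cvgN.
Qed.

Lemma cvgvB u v a b : cvgv F u a -> cvgv F v b ->
  cvgv F (fun k => u k - v k) (a - b).
Proof. by move=> ua vb; apply: cvgvD => //; exact: cvgvN. Qed.

Lemma cvg_ip u v a b : cvgv F u a -> cvgv F v b ->
  ip (u k) (v k) @[k --> F] --> ip a b.
Proof.
move=> ua vb; rewrite ipE; under eq_fun do rewrite ipE.
apply: cvgr_sum => i; have [ua1 ua2] := ua i; have [vb1 vb2] := vb i.
by apply: cvgD; exact: cvgM.
Qed.

Lemma cvg_l1norm u a : cvgv F u a -> l1norm (u k) @[k --> F] --> l1norm a.
Proof.
move=> ua; rewrite /l1norm; apply: cvgr_sum => i; have [ua1 ua2] := ua i.
have sq : (complex.Re (u k i 0) ^+ 2 + complex.Im (u k i 0) ^+ 2) @[k --> F]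
    --> complex.Re (a i 0) ^+ 2 + complex.Im (a i 0) ^+ 2.
  by apply: cvgD; exact: cvgM.
exact: (cvg_comp _ _ sq (@sqrt_continuous R _)).
Qed.

Lemma cvgv_unique u a b : cvgv F u a ->
  ip (u k - b) (u k - b) @[k --> F] --> (0 : R) -> a = b.
Proof.
move=> ua ub; apply/eqP; rewrite -subr_eq0; apply/eqP/ip_eq0.
have ua' : cvgv F (fun k => u k - b) (a - b).
  by apply: cvgvB => //; exact: cvgv_cst.
by apply: (norm_cvg_unique _ ub); exact: cvg_ip.
Qed.

Lemma cvgvZ (c : R) u a : cvgv F u a ->
  cvgv F (fun k => c%:C *: u k) (c%:C *: a).
Proof.
move=> ua; rewrite -mul_scalar_mx.
by under eq_fun do rewrite -mul_scalar_mx; exact: cvgv_mulmx.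
Qed.

Lemma cvgv_subK u a c : cvgv F (fun k => u k - a) c -> cvgv F u (c + a).
Proof.
move=> ua i; have := cvgvD ua (cvgv_cst a) i.
by under [X in X @ _ --> _ /\ _]eq_fun do rewrite subrK;
   under [X in _ /\ X @ _ --> _]eq_fun do rewrite subrK.
Qed.

Lemma cvg_sqrt_ip u : ip (u k) (u k) @[k --> F] --> (0 : R) ->
  Num.sqrt (ip (u k) (u k)) @[k --> F] --> (0 : R).
Proof.
move=> u0; have := cvg_comp _ _ u0 (@sqrt_continuous R 0).
by rewrite sqrtr0.
Qed.

Lemma cvgv_ip0 u : ip (u k) (u k) @[k --> F] --> (0 : R) -> cvgv F u 0.
Proof.
move=> /cvg_sqrt_ip u0 i; rewrite mxE.
have u0N : - Num.sqrt (ip (u k) (u k)) @[k --> F] --> (0 : R).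
  by rewrite -oppr0; exact: cvgN.
have bd k : cmod (u k i 0) <= Num.sqrt (ip (u k) (u k)).
  by rewrite -[cmod _]ger0_norm ?cmod_ge0// -sqrtr_sqr ler_wsqrtr ?cmod_le_ip.
split; apply: (squeeze_cvgr _ u0N u0); apply: filterE => k;
  rewrite -ler_norml; apply: le_trans (bd k);
  by rewrite -sqrtr_sqr ler_wsqrtr// ?lerDl ?lerDr sqr_ge0.
Qed.

End Dim.

End VectorLimits.

Lemma ultra_bounded_cvgv (R : realType) (n : nat) (T : Type)
    (F : set_system T) (u : T -> 'cV[R[i]]_n) (M : R) :
  UltraFilter F -> (forall k i, cmod (u k i 0) <= M) -> exists l, cvgv F u l.
Proof.
move=> UF uM.
have bd (z : R[i]) : `|complex.Re z| <= cmod z /\ `|complex.Im z| <= cmod z.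
  by rewrite /cmod -!sqrtr_sqr !ler_wsqrtr// ?lerDl ?lerDr sqr_ge0.
have /choice[a aP] : forall i, exists a : R,
    complex.Re (u k i 0) @[k --> F] --> a.
  move=> i; apply: (ultra_bounded_cvg (M := M)) => k.
  exact: le_trans (bd _).1 (uM k i).
have /choice[b bP] : forall i, exists b : R,
    complex.Im (u k i 0) @[k --> F] --> b.
  move=> i; apply: (ultra_bounded_cvg (M := M)) => k.
  exact: le_trans (bd _).2 (uM k i).
by exists (\col_i (a i +i* b i)) => i; rewrite mxE/=; split.
Qed.

Lemma ip_bounded_cvgv (R : realType) (n : nat) (T : Type)
    (F : set_system T) (u : T -> 'cV[R[i]]_n) (M : R) :
  UltraFilter F -> (forall k, ip (u k) (u k) <= M) -> exists l, cvgv F u l.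
Proof.
move=> UF uM; apply: (ultra_bounded_cvgv (M := Num.sqrt M)) => // k i.
rewrite -[cmod _]ger0_norm ?cmod_ge0// -sqrtr_sqr ler_wsqrtr//.
exact: le_trans (cmod_le_ip _ _) (uM k).
Qed.

Lemma cvg_finer (T : Type) (R : realType) (G F : set_system T) (u : T -> R)
    (l : R) : G `<=` F -> u k @[k --> G] --> l -> u k @[k --> F] --> l.
Proof. by move=> GF ul B nB; apply: GF; exact: ul. Qed.

Lemma cvgv_finer (T : Type) (R : realType) (n : nat) (G F : set_system T)
    (u : T -> 'cV[R[i]]_n) l : G `<=` F -> cvgv G u l -> cvgv F u l.
Proof. by move=> GF ul i; have [? ?] := ul i; split; exact: cvg_finer GF _. Qed.

Lemma nat_ultrafilter : exists F : set_system nat, UltraFilter F /\ \oo `<=` F.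
Proof. exact: ultraFilterLemma. Qed.

(** * Existence of a saddle point *)

Section SaddlePoint.
Variables (R : realType) (m n : nat) (A : 'M[R[i]]_(m, n)) (b : 'cV[R[i]]_m).
Variable delta : R.
Hypothesis delta0 : 0 < delta.

Let ball0 : @l2ball R m delta 0.
Proof. by apply/l2ballP; [exact: ltW|rewrite ip0l sqr_ge0]. Qed.

(** Minimality of [(x, r)] for the Lagrangian with multiplier [y] over all [z] and all [q] in the
    ball; [b] cancels in the difference. *)
Definition saddle_ineq (r : 'cV[R[i]]_m) (x : 'cV[R[i]]_n) (y : 'cV[R[i]]_m) :=
  forall z q, l2ball delta q ->
    ip y (A *m (z - x) + (q - r)) <= l1norm z - l1norm x.

Definition saddle_point r x y :=
  [/\ A *m x + r = b, l2ball delta r & saddle_ineq r x y].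

(** Between two feasible points the multiplier term of the saddle inequality vanishes. *)
Lemma saddle_point_solution r x y :
  saddle_point r x y -> bp_solution A b delta r x.
Proof.
move=> [Axr br sp]; split=> // r' x' [Axr' br'].
rewrite -subr_ge0; apply: le_trans (sp x' r' br').
suff -> : A *m (x' - x) + (r' - r) = 0 by rewrite ip0r.
by rewrite mulmxBr addrACA -opprD Axr Axr' subrr.
Qed.

Let pen (c : R) (x : 'cV[R[i]]_n) (r : 'cV[R[i]]_m) :=
  l1norm x + c * ip (A *m x + r - b) (A *m x + r - b).

(** Direct method: along a minimizing sequence the penalized value bounds [|x|_1] and the ball
    bounds [r], so an ultrafilter limit exists, and the objective is continuous. *)
Lemma penalized_min_exists (c : R) : 0 <= c -> exists x r, l2ball delta r /\
  forall z q, l2ball delta q -> pen c x r <= pen c z q.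
Proof.
move=> c0; pose E := [set s | exists z q, l2ball delta q /\ s = pen c z q].
have pen0 x r : 0 <= pen c x r.
  by rewrite addr_ge0 ?l1norm_ge0// mulr_ge0// ip_ge0.
have infE : has_inf E.
  split; first by exists (pen c 0 0), 0, 0.
  by exists 0 => _ [z [q [_ ->]]].
have /choice[s sP] : forall k, exists p : 'cV[R[i]]_n * 'cV[R[i]]_m,
    l2ball delta p.2 /\ pen c p.1 p.2 < inf E + harmonic k.
  move=> k; have [_ [z [q [bq ->]]] lt] := inf_adherent (harmonic_gt0 k) infE.
  by exists (z, q).
have [F [UF ooF]] := nat_ultrafilter.
have [x sx] : exists x, cvgv F (fun k => (s k).1) x.
  apply: (ultra_bounded_cvgv (M := inf E + 1)) => k i.
  apply: le_trans (cmod_le_l1 _ _) _.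
  have : pen c (s k).1 (s k).2 <= inf E + 1.
    apply: le_trans (ltW (sP k).2) _; rewrite lerD2l /harmonic/=.
    by rewrite invf_le1// ler1n.
  by apply: le_trans; rewrite lerDl mulr_ge0// ip_ge0.
have [r sr] : exists r, cvgv F (fun k => (s k).2) r.
  apply: (ip_bounded_cvgv (M := delta ^+ 2)) => k.
  by apply/l2ballP; [exact: ltW|exact: (sP k).1].
exists x, r; split.
  apply/l2ballP; first exact: ltW.
  apply: (cvgr_to_le (cvg_ip _ sr sr)); apply: filterE => k.
  by apply/l2ballP; [exact: ltW|exact: (sP k).1].
move=> z q bq; apply: (@le_trans _ _ (inf E)); last first.
  by apply: ge_inf; [exact: infE.2|exists z, q].
have pcvg : pen c (s k).1 (s k).2 @[k --> F] --> pen c x r.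
  have ecvg : cvgv F (fun k => A *m (s k).1 + (s k).2 - b) (A *m x + r - b).
    by apply: cvgvB; [apply: cvgvD => //; exact: cvgv_mulmx|exact: cvgv_cst].
  by apply: cvgD; [exact: cvg_l1norm|apply: cvgMl_tmp; exact: cvg_ip].
have hcvg : inf E + harmonic k @[k --> F] --> inf E + 0.
  apply: cvgD; first exact: cvg_cst.
  exact: cvg_finer (@cvg_harmonic R).
rewrite -[leRHS]addr0; apply: (ler_cvg_to pcvg hcvg).
by apply: filterE => k; exact: ltW (sP k).2.
Qed.

(* The multiplier is the scaled residual of a minimizer of the penalized
   problem. *)
Lemma penalized_saddle (e : R) : 0 < e -> exists x r y,
  [/\ l2ball delta r, b - (A *m x + r) = e%:C *: y & saddle_ineq r x y].
Proof.
move=> e0; have c0 : 0 <= (2 * e)^-1 by rewrite invr_ge0 mulr_ge0// ltW.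
have [x [r [br xmin]]] := penalized_min_exists c0.
exists x, r, (e^-1%:C *: (b - (A *m x + r))); split=> //.
  by rewrite scalerA -rmorphM/= mulfV ?gt_eqF// scale1r.
move=> z q bq; set d := A *m (z - x) + (q - r); rewrite -subr_ge0.
(* First variation along the segment towards [(z, q)]: the l1 part is convex and the penalty leaves
   a remainder of order [t^2]. *)
apply: (@ge0_of_small_slope R _ ((2 * e)^-1 * ip d d)) => t t0 t1.
have := xmin (x + t%:C *: (z - x)) _
  (l2ball_convex (ltW delta0) br bq (ltW t0) t1).
rewrite /pen; set w := A *m x + r - b.
have -> : A *m (x + t%:C *: (z - x)) + (r + t%:C *: (q - r)) - b
    = w + t%:C *: d.
  by rewrite mulmxDr -scalemxAr addrACA -scalerDr -/d [LHS]addrAC.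
have -> : b - (A *m x + r) = - w by rewrite opprB.
have := l1norm_convex x z (ltW t0) t1.
move: w d => w d; rewrite !ip_lin (ipC d w) => h1 h2.
rewrite -(pmulr_rge0 _ t0).
have h3 := le_trans h2 (lerD h1 (lexx _)).
have E : e^-1 = 2 * (2 * e)^-1 by field; rewrite gt_eqF.
rewrite E; lra.
Qed.

(** The bound does not depend on [e], which keeps the multipliers bounded as [e] tends to 0. *)
Lemma approx_multiplier_bound (e : R) r x y x0 : 0 < e -> A *m x0 = b ->
  b - (A *m x + r) = e%:C *: y -> saddle_ineq r x y ->
  l1norm x + delta * l2norm y <= l1norm x0.
Proof.
move=> e0 Ax0 yE sp; have [y0|y0] := eqVneq (ip y y) 0.
  have := sp x0 0 ball0.
  by rewrite (ip_eq0 y0) ip0l l2normE ip0l sqrtr0 mulr0 addr0 subr_ge0.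
pose s := l2norm y; have sE : ip y y = s ^+ 2.
  by rewrite /s l2normE sqr_sqrtr// ip_ge0.
have s0 : 0 < s by rewrite /s l2normE sqrtr_gt0 lt0r y0 ip_ge0.
(* The test point of the sphere is aligned with [y], so the left side becomes
   [e |y|^2 + delta |y|]. *)
have := sp x0 ((delta / s)%:C *: y).
have -> : A *m (x0 - x) + ((delta / s)%:C *: y - r)
    = e%:C *: y + (delta / s)%:C *: y.
  by rewrite mulmxBr Ax0 -yE opprD [_ *: y - r]addrC !addrA.
rewrite !ip_lin sE -/s => /(_ _) h.
have : delta / s * s ^+ 2 = delta * s by field; rewrite gt_eqF.
have := mulr_ge0 (ltW e0) (sqr_ge0 s).
suff /h : l2ball delta ((delta / s)%:C *: y) by lra.
apply/l2ballP; first exact: ltW.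
rewrite !ip_lin sE le_eqVlt; apply/orP; left; apply/eqP; field.
by rewrite gt_eqF.
Qed.

Lemma saddle_point_exists x0 : A *m x0 = b -> exists r x y, saddle_point r x y.
Proof.
move=> Ax0.
have /choice[s sP] : forall k,
    exists p : 'cV[R[i]]_n * 'cV[R[i]]_m * 'cV[R[i]]_m,
    [/\ l2ball delta p.1.2,
        b - (A *m p.1.1 + p.1.2) = (harmonic k)%:C *: p.2 &
        saddle_ineq p.1.2 p.1.1 p.2].
  move=> k; have [x [r [y H]]] := penalized_saddle (harmonic_gt0 k).
  by exists (x, r, y).
have [F [UF ooF]] := nat_ultrafilter.
have bnd k : l1norm (s k).1.1 + delta * l2norm (s k).2 <= l1norm x0.
  have [_ s2 s3] := sP k.
  exact: approx_multiplier_bound (harmonic_gt0 k) Ax0 s2 s3.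
have [x sx] : exists x, cvgv F (fun k => (s k).1.1) x.
  apply: (ultra_bounded_cvgv (M := l1norm x0)) => k i.
  apply: le_trans (cmod_le_l1 _ _) (le_trans _ (bnd k)).
  by rewrite lerDl mulr_ge0 ?sqrtr_ge0// ltW.
have [r sr] : exists r, cvgv F (fun k => (s k).1.2) r.
  apply: (ip_bounded_cvgv (M := delta ^+ 2)) => k.
  by apply/l2ballP; [exact: ltW|case: (sP k)].
have [y sy] : exists y, cvgv F (fun k => (s k).2) y.
  apply: (ip_bounded_cvgv (M := (l1norm x0 / delta) ^+ 2)) => k.
  rewrite -l2norm_le ?divr_ge0 ?l1norm_ge0 ?(ltW delta0)//.
  rewrite ler_pdivlMr// mulrC; apply: le_trans (bnd k).
  by rewrite lerDr l1norm_ge0.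
exists r, x, y; split.
- have rcvg : cvgv F (fun k => A *m (s k).1.1 + (s k).1.2) (A *m x + r).
    by apply: cvgvD => //; exact: cvgv_mulmx.
  apply: (cvgv_unique _ rcvg).
  have hcvg : harmonic k @[k --> F] --> (0 : R).
    exact: cvg_finer (@cvg_harmonic R).
  (* The squared residual is [harmonic k ^+ 2] times the convergent [|y_k|^2], so the limit is
     exactly feasible. *)
  have := cvgM hcvg (cvgM hcvg (cvg_ip _ sy sy)); rewrite !mul0r.
  rewrite (_ : (_ : nat -> R) \* _ = fun k =>
    ip (A *m (s k).1.1 + (s k).1.2 - b) (A *m (s k).1.1 + (s k).1.2 - b));
    first exact.
  apply/funext => k; have [_ H _] := sP k.
  by rewrite -[_ - b]opprB H !ip_lin opprK.
- apply/l2ballP; first exact: ltW.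
  apply: (cvgr_to_le (cvg_ip _ sr sr)); apply: filterE => k.
  by apply/l2ballP; [exact: ltW|case: (sP k)].
- move=> z q bq.
  apply: (@ler_cvg_to nat F _ _ (fun k => ip (s k).2
    (A *m (z - (s k).1.1) + (q - (s k).1.2)))
    (fun k => l1norm z - l1norm (s k).1.1)).
  + apply: cvg_ip => //; apply: cvgvD; last first.
      by apply: cvgvB => //; exact: cvgv_cst.
    by apply: cvgv_mulmx; apply: cvgvB => //; exact: cvgv_cst.
  + by apply: cvgB; [exact: cvg_cst|exact: cvg_l1norm].
  + by apply: filterE => k; have [_ _] := sP k; exact.
Qed.

End SaddlePoint.

(** * One step of the iteration *)

Lemma ip_addsq (R : realType) (n : nat) (u v : 'cV[R[i]]_n) :
  ip (u + v) (u + v) = ip u u + 2 * ip u v + ip v v.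
Proof. by rewrite ipDl !ipDr (ipC v u); ring. Qed.

Lemma ip_subZsq (R : realType) (n : nat) (u v : 'cV[R[i]]_n) (c : R) :
  ip (u - c%:C *: v) (u - c%:C *: v)
  = ip u u - 2 * c * ip u v + c ^+ 2 * ip v v.
Proof. by rewrite ip_addsq ipNl !ipNr ipZl !ipZr; ring. Qed.

(* [aa], ..., [hh] stand for the inner products occurring in [step_fejer]. *)
Lemma fejer_scalar (R : realFieldType)
    (tau gamma beta mu l aa dd ee ae xd he ye xx hh L L' : R) :
  0 < tau -> 0 < gamma -> 0 < beta -> 0 < mu -> aa <= l * dd ->
  0 <= aa - 2 * mu * ae + mu ^+ 2 * ee ->
  ye <= L - L' ->
  - he - ye + beta * (ee - ae) + beta / tau * (xd + dd) <= L' - L ->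
  beta / tau * (xx + 2 * xd + dd)
    + (gamma * beta)^-1 * (hh - 2 * (gamma * beta) * he
                           + (gamma * beta) ^+ 2 * ee)
    + beta * (tau^-1 - l / mu) * dd + beta * (2 - gamma - mu) * ee
  <= beta / tau * xx + (gamma * beta)^-1 * hh.
Proof.
move=> tau0 gamma0 beta0 mu0 ray young s1 s2.
(* The square of [A (x' - x) - mu e], with [|A (x' - x)|^2] enlarged to [l |x' - x|^2]. *)
have young' : 0 <= beta / mu * (l * dd - 2 * mu * ae + mu ^+ 2 * ee).
  by rewrite mulr_ge0 ?divr_ge0 ?(ltW beta0) ?(ltW mu0)//; clear s1 s2; lra.
(* Adding [s1] and [s2] cancels the objective values and the term in the saddle multiplier. *)
have s12 : 0 <= he - beta * (ee - ae) - beta / tau * (xd + dd) by lra.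
rewrite -subr_ge0.
rewrite (_ : _ - _ = 2 * (he - beta * (ee - ae) - beta / tau * (xd + dd))
  + beta / mu * (l * dd - 2 * mu * ae + mu ^+ 2 * ee)).
  by rewrite addr_ge0// mulr_ge0.
by field; rewrite !gt_eqF.
Qed.

Section Step.
Variables (R : realType) (m n : nat) (A : 'M[R[i]]_(m, n)) (b : 'cV[R[i]]_m).
Variables (delta tau gamma beta : R).
Hypotheses (delta0 : 0 < delta) (tau0 : 0 < tau) (gamma0 : 0 < gamma).
Hypothesis beta0 : 0 < beta.
Variables (x x' : 'cV[R[i]]_n) (y y' r' : 'cV[R[i]]_m).
Hypothesis rE : r' = euclid_proj (@l2ball R m delta)
  (beta^-1%:C *: y - (A *m x - b)).
Hypothesis xE : x' = shrink (x - tau%:C *: (A ^t* *m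
  (A *m x + r' - b - beta^-1%:C *: y))) (tau / beta).
Hypothesis yE : y' = y - (gamma * beta)%:C *: (A *m x' + r' - b).

Lemma step_ball : l2ball delta r'.
Proof.
rewrite rE.
by have [] := euclid_projP (ltW delta0) (beta^-1%:C *: y - (A *m x - b)).
Qed.

(* The iterate satisfies the saddle inequality for the predicted multiplier
   [y - beta (A x + r' - b)], up to the proximal term in [x - x']. *)
Lemma step_saddle z q : l2ball delta q ->
  ip (y - beta%:C *: (A *m x + r' - b)) (A *m (z - x') + (q - r'))
    + beta / tau * ip (x - x') (z - x') <= l1norm z - l1norm x'.
Proof.
move=> bq; set w := A *m x + r' - b; pose g := w - beta^-1%:C *: y.
have bne : beta != 0 by rewrite gt_eqF.
have tne : tau != 0 by rewrite gt_eqF.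
have -> : y - beta%:C *: w = - (beta%:C *: g).
  apply/colP => i; rewrite /g; clearbody w; rewrite !mxE mulrBr opprB mulrA.
  by rewrite -rmorphM/= mulfV// mul1r.
have : ip (- g) (q - r') <= 0.
  have [_] := euclid_projP (ltW delta0) (beta^-1%:C *: y - (A *m x - b)).
  rewrite -rE => /(_ q bq).
  suff -> : beta^-1%:C *: y - (A *m x - b) - r' = - g by [].
  by rewrite [- g]opprB -addrA -opprD [A *m x - b + r']addrAC.
have : ip (x - tau%:C *: (A ^t* *m g) - x') (z - x')
    <= tau / beta * (l1norm z - l1norm x').
  have := @shrinkP R n (x - tau%:C *: (A ^t* *m g)) z (tau / beta).
  by rewrite -xE; apply; rewrite divr_ge0// ltW.
have -> : ip (x - tau%:C *: (A ^t* *m g) - x') (z - x')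
    = ip (x - x') (z - x') - tau * ip g (A *m (z - x')).
  by rewrite addrAC [LHS]ipDl ipNl ipZl -ip_mulmxr.
rewrite [ip (- (_ *: g)) _]ipNl ipZl [ip g (_ + _)]ipDr [ip (- g) _]ipNl.
move: (ip (x - x') _) (ip g (q - _)) (ip g _) (l1norm z - l1norm x').
(* The shrinkage inequality times [beta / tau] and the projection inequality times [beta] add up to
   the claim. *)
move=> p1 p2 p3 L h1 h2.
have := ler_wpM2l (ltW (divr_gt0 beta0 tau0)) h1.
rewrite (_ : beta / tau * (tau / beta * L) = L); last by field; rewrite bne tne.
rewrite (_ : beta / tau * (p1 - tau * p3) = beta / tau * p1 - beta * p3);
  last by field.
have : 0 <= beta * p2 by rewrite mulr_ge0 ?(ltW beta0)// -oppr_le0.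
lra.
Qed.

Lemma step_fejer (l mu : R) rt xt yt :
  is_max_eigenvalue (A ^t* *m A) l -> 0 < mu ->
  saddle_point A b delta rt xt yt ->
  beta / tau * ip (x' - xt) (x' - xt)
    + (gamma * beta)^-1 * ip (y' - yt) (y' - yt)
    + beta * (tau^-1 - l / mu) * ip (x' - x) (x' - x)
    + beta * (2 - gamma - mu) * ip (A *m x' + r' - b) (A *m x' + r' - b)
  <= beta / tau * ip (x - xt) (x - xt)
    + (gamma * beta)^-1 * ip (y - yt) (y - yt).
Proof.
move=> hl mu0 [Axr brt sp]; have ray := rayleigh_le (x' - x) hl.
have eE : A *m (x' - xt) + (r' - rt) = A *m x' + r' - b.
  by rewrite mulmxBr addrACA -opprD Axr.
(* The saddle inequality is tested at the new iterate, then the inequality of the iterate at the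
   saddle point. *)
have s1 := sp x' r' step_ball; rewrite eE in s1.
have s2 := step_saddle xt brt.
have e2E : A *m (xt - x') + (rt - r') = - (A *m x' + r' - b).
  by rewrite -eE opprD !opprB -mulmxN opprB.
(* The step uses the residual at the old [x]; rewriting it with the new one produces the cross
   term. *)
have wE : A *m x + r' - b = (A *m x' + r' - b) - A *m (x' - x).
  rewrite mulmxBr; move: (A *m x) (A *m x') => p q.
  by apply/colP => i; rewrite !mxE; ring.
have dE : x - x' = - (x' - x) by rewrite opprB.
have xtE : xt - x' = - ((x - xt) + (x' - x)).
  by rewrite [x - xt + _]addrC addrA subrK opprB.
rewrite e2E wE dE xtE in s2.
have -> : x' - xt = (x - xt) + (x' - x) by rewrite [RHS]addrC addrA subrK.
have -> : y' - yt = (y - yt) - (gamma * beta)%:C *: (A *m x' + r' - b).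
  by rewrite yE addrAC.
have yK : y = (y - yt) + yt by rewrite subrK.
have young := ip_ge0 (A *m (x' - x) - mu%:C *: (A *m x' + r' - b)).
move: yK ray s1 s2 young {eE e2E wE dE xtE}.
move: (A *m x' + r' - b) => e; move: (A *m (x' - x)) => ad.
move: (x' - x) (x - xt) (y - yt) => dx xi eta yK ray s1 s2 young.
have s2E : ip (y - beta%:C *: (e - ad)) (- e)
    = - ip eta e - ip yt e + beta * (ip e e - ip ad e).
  by rewrite yK ipNr ipDl ipNl ipZl 2!ipDl ipNl; ring.
have dE : ip (- dx) (- (xi + dx)) = ip xi dx + ip dx dx.
  by rewrite ipNl ipNr opprK ipDr (ipC dx xi).
rewrite s2E dE in s2; rewrite ip_subZsq in young.
rewrite ip_addsq ip_subZsq; exact: fejer_scalar ray young s1 s2.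
Qed.

End Step.

(** * Convergence *)

Lemma cvgv_l2cvg (R : realType) (n : nat) (u : nat -> 'cV[R[i]]_n) l :
  cvgv \oo u l -> l2cvg u l.
Proof.
move=> ul; rewrite /l2cvg; under eq_fun do rewrite l2normE.
apply: cvg_sqrt_ip; rewrite -(ip0l (0 : 'cV[R[i]]_n)) -(subrr l).
have ul' : cvgv \oo (fun k => u k - l) (l - l).
  by apply: cvgvB => //; exact: cvgv_cst.
exact: cvg_ip.
Qed.

(** * Sequences with summable decrease *)

Section Descent.
Variables (R : realType) (phi d : nat -> R).
Hypothesis phi0 : forall k, 0 <= phi k.
Hypothesis d0 : forall k, 0 <= d k.
Hypothesis desc : forall k, phi k.+1 + d k <= phi k.

Lemma descent_noninc : {homo phi : i j / (i <= j)%N >-> j <= i}.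
Proof.
apply: homo_leq => [//|y x z xy yz|k]; first exact: le_trans yz xy.
by apply: le_trans (desc k); rewrite lerDl.
Qed.

Lemma descent_cvg : exists l, phi k @[k --> \oo] --> (l : R).
Proof.
exists (limn phi); apply: nonincreasing_is_cvgn; first exact: descent_noninc.
by exists 0 => _ [k _ <-].
Qed.

Lemma descent_gap_cvg0 : d k @[k --> \oo] --> (0 : R).
Proof.
have [l phil] := descent_cvg.
have phiS : phi k.+1 @[k --> \oo] --> (l : R) by rewrite cvg_shiftS.
have gap : phi k - phi k.+1 @[k --> \oo] --> (0 : R).
  by rewrite -(subrr l); exact: cvgB.
apply: (squeeze_cvgr _ (cvg_cst (0 : R)) gap); apply: filterE => k.
by rewrite d0 /= lerBrDl.
Qed.

(** A monotone [phi] already converges along [\oo], so its limit can be read off any finer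
    filter. *)
Lemma descent_ultra_cvg0 (F : set_system nat) : ProperFilter F ->
  \oo `<=` F -> phi k @[k --> F] --> (0 : R) -> phi k @[k --> \oo] --> (0 : R).
Proof.
move=> FF ooF phiF; have [l phil] := descent_cvg.
by rewrite -(norm_cvg_unique (cvg_finer ooF phil) phiF).
Qed.

End Descent.

Lemma cvg0_le_scale (R : realType) (T : Type) (F : set_system T) (f g : T -> R)
    (c : R) : ProperFilter F -> 0 < c -> (forall k, 0 <= f k) ->
  (forall k, c * f k <= g k) -> g k @[k --> F] --> (0 : R) ->
  f k @[k --> F] --> (0 : R).
Proof.
move=> FF c0 f0 fg g0.
have g0' : c^-1 * g k @[k --> F] --> (0 : R).
  by rewrite -(mulr0 c^-1); exact: cvgMl_tmp.
apply: (squeeze_cvgr _ (cvg_cst (0 : R)) g0'); apply: filterE => k.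
by rewrite f0/= ler_pdivlMl.
Qed.

Section Convergence.
Variables (R : realType) (m n : nat) (A : 'M[R[i]]_(m, n)) (b : 'cV[R[i]]_m).
Variables (delta tau gamma beta l : R).
Hypotheses (delta0 : 0 < delta) (tau0 : 0 < tau) (gamma0 : 0 < gamma).
Hypotheses (beta0 : 0 < beta) (n0 : (0 < n)%N).
Hypothesis hl : is_max_eigenvalue (A ^t* *m A) l.
Hypothesis hstep : tau * l + gamma < 2.
Variables (r : nat -> 'cV[R[i]]_m) (x : nat -> 'cV[R[i]]_n).
Variable y : nat -> 'cV[R[i]]_m.
Hypothesis rE : forall k, r k.+1 = euclid_proj (@l2ball R m delta)
  (beta^-1%:C *: y k - (A *m x k - b)).
Hypothesis xE : forall k, x k.+1 = shrink (x k - tau%:C *: (A ^t* *m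
  (A *m x k + r k.+1 - b - beta^-1%:C *: y k))) (tau / beta).
Hypothesis yE : forall k,
  y k.+1 = y k - (gamma * beta)%:C *: (A *m x k.+1 + r k.+1 - b).

(* The parameter of Young's inequality, midway between [tau * l] and
   [2 - gamma]. *)
Let mu := (tau * l + (2 - gamma)) / 2.
(** The gains on [|dx|^2] and [|e|^2] per step: [tau l < mu] makes [kx] positive and
    [mu < 2 - gamma] makes [ke] positive. *)
Let kx := beta * (tau^-1 - l / mu).
Let ke := beta * (2 - gamma - mu).
Let dx k := x k.+1 - x k.
Let e k := A *m x k.+1 + r k.+1 - b.
Let phi xt yt k := beta / tau * ip (x k - xt) (x k - xt)
    + (gamma * beta)^-1 * ip (y k - yt) (y k - yt).

(** The Rayleigh bound at a nonzero vector, which exists since [n] is positive. *)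
Lemma max_eigenvalue_ge0 : 0 <= l.
Proof.
pose u : 'cV[R[i]]_n := const_mx 1.
have u0 : 0 < ip u u.
  rewrite lt0r ip_ge0 andbT; apply/eqP => /ip_eq0/matrixP/(_ (Ordinal n0) 0).
  by rewrite !mxE => /eqP; rewrite oner_eq0.
rewrite -(pmulr_lge0 _ u0); apply: le_trans (rayleigh_le u hl).
exact: ip_ge0.
Qed.

Let mu0 : 0 < mu.
Proof.
have tl : 0 <= tau * l by rewrite mulr_ge0 ?max_eigenvalue_ge0// ltW.
rewrite divr_gt0//; have := hstep; lra.
Qed.

Let kx0 : 0 < kx.
Proof.
rewrite mulr_gt0// subr_gt0 ltr_pdivrMr// ltr_pdivlMl//.
by rewrite ltr_pdivlMr//; have := hstep; lra.
Qed.

Let ke0 : 0 < ke.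
Proof.
by rewrite mulr_gt0// subr_gt0 ltr_pdivrMr//; have := hstep; lra.
Qed.

Section Fejer.
Variables (rt yt : 'cV[R[i]]_m) (xt : 'cV[R[i]]_n).
Hypothesis sp : saddle_point A b delta rt xt yt.

Let ax0 : 0 < beta / tau. Proof. by rewrite divr_gt0. Qed.
Let ay0 : 0 < (gamma * beta)^-1. Proof. by rewrite invr_gt0 mulr_gt0. Qed.

Lemma phi_ge0 k : 0 <= phi xt yt k.
Proof. by rewrite addr_ge0// mulr_ge0 ?ip_ge0 ?ltW. Qed.

Let gap_ge0 k : 0 <= kx * ip (dx k) (dx k) + ke * ip (e k) (e k).
Proof. by rewrite addr_ge0// mulr_ge0 ?ip_ge0 ?ltW. Qed.

Lemma phi_descent k : phi xt yt k.+1
  + (kx * ip (dx k) (dx k) + ke * ip (e k) (e k)) <= phi xt yt k.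
Proof.
rewrite addrA.
exact: (step_fejer delta0 tau0 gamma0 beta0 (rE k) (xE k) (yE k) hl mu0 sp).
Qed.

Lemma increments_cvg0 : cvgv \oo dx 0 /\ cvgv \oo e 0.
Proof.
have gap0 := descent_gap_cvg0 phi_ge0 gap_ge0 phi_descent.
split; apply: cvgv_ip0.
  apply: (cvg0_le_scale _ kx0 _ _ gap0) => k; first exact: ip_ge0.
  by rewrite lerDl mulr_ge0 ?ip_ge0 ?ltW.
apply: (cvg0_le_scale _ ke0 _ _ gap0) => k; first exact: ip_ge0.
by rewrite lerDr mulr_ge0 ?ip_ge0 ?ltW.
Qed.

Lemma phi_x_le k : beta / tau * ip (x k - xt) (x k - xt) <= phi xt yt k.
Proof. by rewrite lerDl mulr_ge0 ?ip_ge0 ?ltW. Qed.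

Lemma phi_y_le k : (gamma * beta)^-1 * ip (y k - yt) (y k - yt) <= phi xt yt k.
Proof. by rewrite lerDr mulr_ge0 ?ip_ge0 ?ltW. Qed.

Lemma ultra_iterates_cvg (F : set_system nat) : UltraFilter F ->
  (exists x', cvgv F x x') /\ (exists y', cvgv F y y').
Proof.
move=> UF.
have bnd k := descent_noninc gap_ge0 phi_descent (leq0n k).
split.
  have [u xu] : exists u, cvgv F (fun k => x k - xt) u.
    apply: (ip_bounded_cvgv (M := (beta / tau)^-1 * phi xt yt 0)) => k.
    by rewrite ler_pdivlMl//; exact: le_trans (phi_x_le k) (bnd k).
  by exists (u + xt); exact: cvgv_subK.
have [u yu] : exists u, cvgv F (fun k => y k - yt) u.
  apply: (ip_bounded_cvgv (M := ((gamma * beta)^-1)^-1 * phi xt yt 0)) => k.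
  by rewrite ler_pdivlMl//; exact: le_trans (phi_y_le k) (bnd k).
by exists (u + yt); exact: cvgv_subK.
Qed.

(** The distance [phi] to this saddle point tends to 0 along [F], hence along [\oo] by
    monotonicity. *)
Lemma fejer_cvg (F : set_system nat) : ProperFilter F -> \oo `<=` F ->
  cvgv F x xt -> cvgv F y yt -> cvgv \oo x xt /\ cvgv \oo y yt.
Proof.
move=> FF ooF xF yF.
have phiF : phi xt yt k @[k --> F] --> (0 : R).
  have cst N (a : 'cV[R[i]]_N) := cvgv_cst FF a.
  have xF' := cvgvB FF xF (cst _ xt); have yF' := cvgvB FF yF (cst _ yt).
  have xx := cvg_ip FF xF' xF'; have yy := cvg_ip FF yF' yF'.
  rewrite subrr ip0l in xx; rewrite subrr ip0l in yy.
  have -> : (0 : R) = beta / tau * 0 + (gamma * beta)^-1 * 0.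
    by rewrite !mulr0 addr0.
  by apply: cvgD; [exact: (cvgMl_tmp xx)|exact: (cvgMl_tmp yy)].
have phioo := descent_ultra_cvg0 phi_ge0 gap_ge0 phi_descent FF ooF phiF.
split; rewrite -[X in cvgv _ _ X]add0r; apply: cvgv_subK; apply: cvgv_ip0.
  by apply: (cvg0_le_scale _ ax0 _ phi_x_le phioo) => k; exact: ip_ge0.
by apply: (cvg0_le_scale _ ay0 _ phi_y_le phioo) => k; exact: ip_ge0.
Qed.

End Fejer.

(** * Limit points are saddle points *)

Section LimitPoint.
Variables (F : set_system nat) (xt : 'cV[R[i]]_n).
Hypothesis FF : ProperFilter F.
Hypotheses (dxF : cvgv F dx 0) (eF : cvgv F e 0) (xF : cvgv F x xt).

Lemma shifted_x_cvg : cvgv F (fun k => x k.+1) xt.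
Proof.
have := cvgvD FF dxF xF; rewrite add0r.
suff -> : (fun k => dx k + x k) = (fun k => x k.+1) by [].
by apply/funext => k; rewrite subrK.
Qed.

(** [r] is recovered from the residual and [x]. The filter is general because this serves both the
    ultrafilter and, at the end, [\oo]. *)
Lemma shifted_r_cvg : cvgv F (fun k => r k.+1) (b - A *m xt).
Proof.
have := cvgvB FF eF (cvgvB FF (cvgv_mulmx FF A shifted_x_cvg) (cvgv_cst FF b)).
rewrite sub0r opprB.
suff -> : (fun k => e k - (A *m x k.+1 - b)) = (fun k => r k.+1) by [].
by apply/funext => k; rewrite /e opprB addrA subrK addrAC subrr add0r.
Qed.

Lemma limit_saddle yt : cvgv F y yt ->
  saddle_point A b delta (b - A *m xt) xt yt.
Proof.
move=> yF; split; first by rewrite addrC subrK.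
  apply/l2ballP; first exact: ltW.
  apply: (cvgr_to_le (cvg_ip _ shifted_r_cvg shifted_r_cvg)).
  apply: filterE => k.
  by apply/l2ballP; [exact: ltW|exact: (step_ball delta0 (rE k))].
move=> z q bq.
(* This is the residual at the old [x k]; it tends to 0, so the predicted multiplier has the same
   limit as [y k]. *)
pose w k := e k - A *m dx k.
have wE k : A *m x k + r k.+1 - b = w k.
  rewrite /w /e /dx mulmxBr; move: (A *m x k) (A *m x k.+1) => u v.
  by apply/colP => i; rewrite !mxE; ring.
have wF : cvgv F (fun k => y k - beta%:C *: w k) yt.
  have := cvgvB FF yF (cvgvZ FF beta (cvgvB FF eF (cvgv_mulmx FF A dxF))).
  by rewrite mulmx0 subrr scaler0 subr0.
have zF : cvgv F (fun k => z - x k.+1) (z - xt).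
  by apply: cvgvB => //; [exact: cvgv_cst|exact: shifted_x_cvg].
have qF : cvgv F (fun k => q - r k.+1) (q - (b - A *m xt)).
  by apply: cvgvB => //; [exact: cvgv_cst|exact: shifted_r_cvg].
have dF : cvgv F (fun k => x k - x k.+1) (xt - xt).
  by apply: cvgvB => //; exact: shifted_x_cvg.
have lhs : ip (y k - beta%:C *: w k) (A *m (z - x k.+1) + (q - r k.+1))
      + beta / tau * ip (x k - x k.+1) (z - x k.+1) @[k --> F]
    --> ip yt (A *m (z - xt) + (q - (b - A *m xt))) + beta / tau * 0.
  apply: cvgD.
    by apply: cvg_ip => //; apply: cvgvD => //; exact: cvgv_mulmx.
  by apply: cvgMl_tmp; rewrite -(ip0l (z - xt)) -(subrr xt); exact: cvg_ip.
have rhs : l1norm z - l1norm (x k.+1) @[k --> F] --> l1norm z - l1norm xt.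
  apply: cvgB; first exact: cvg_cst.
  by apply: cvg_l1norm => //; exact: shifted_x_cvg.
rewrite -[leLHS]addr0 -[X in _ + X](mulr0 (beta / tau)).
apply: (ler_cvg_to lhs rhs); apply: filterE => k; rewrite -wE.
exact: (step_saddle delta0 tau0 beta0 (rE k) (xE k) _ bq).
Qed.

End LimitPoint.

End Convergence.

Theorem theorem2p2 (R : realType) (m n : nat) (hm : (0 < m)%N) (hmn : (m < n)%N)
  (A : 'M[R[i]]_(m, n)) (b : 'cV[R[i]]_m)
  (hAb : exists x : 'cV[R[i]]_n, A *m x = b)
  (delta : R) (hdelta : 0 < delta)
  (lmax : R) (hlmax : is_max_eigenvalue (A ^t* *m A) lmax)
  (tau gamma : R) (htau : 0 < tau) (hgamma : 0 < gamma)
  (hstep : tau * lmax + gamma < 2)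
  (beta : R) (hbeta : 0 < beta)
  (r : nat -> 'cV[R[i]]_m) (x : nat -> 'cV[R[i]]_n) (y : nat -> 'cV[R[i]]_m)
  (hr : forall k : nat,
    r k.+1 = euclid_proj (@l2ball R m delta)
               (beta^-1%:C *: y k - (A *m x k - b)))
  (hx : forall k : nat,
    let g := A ^t* *m (A *m x k + r k.+1 - b - beta^-1%:C *: y k) in
    x k.+1 = shrink (x k - tau%:C *: g) (tau / beta))
  (hy : forall k : nat,
    y k.+1 = y k - (gamma * beta)%:C *: (A *m x k.+1 + r k.+1 - b)) :
  exists (rt : 'cV[R[i]]_m) (xt : 'cV[R[i]]_n) (yt : 'cV[R[i]]_m),
    [/\ l2cvg r rt, l2cvg x xt, l2cvg y yt & bp_solution A b delta rt xt].
Proof.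
have n0 : (0 < n)%N by exact: ltn_trans hmn.
have [x0 Ax0] := hAb.
(* This saddle point only yields boundedness and vanishing increments; the limit [sp] found below
   may be another one. *)
have [rs [xs [ys sps]]] := saddle_point_exists hdelta Ax0.
have [F [UF ooF]] := nat_ultrafilter.
have PF : ProperFilter F by exact: ultra_proper.
have [dx0 e0] := increments_cvg0 hdelta htau hgamma hbeta n0 hlmax hstep
  hr hx hy sps.
have [[xt xF] [yt yF]] := ultra_iterates_cvg hdelta htau hgamma hbeta n0 hlmax
  hstep hr hx hy sps UF.
have sp := limit_saddle hdelta htau hbeta hr hx PF (cvgv_finer ooF dx0)
  (cvgv_finer ooF e0) xF yF.
have [xoo yoo] := fejer_cvg hdelta htau hgamma hbeta n0 hlmax hstep hr hx hy sp
  PF ooF xF yF.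
exists (b - A *m xt), xt, yt; split.
(* The recursion determines [r] from index 1 on, so its convergence is proved for the shifted
   sequence. *)
- rewrite /l2cvg -(cvg_shiftS (fun k => l2norm (r k - (b - A *m xt)))).
  by apply: cvgv_l2cvg; exact: shifted_r_cvg dx0 e0 xoo.
- exact: cvgv_l2cvg.
- exact: cvgv_l2cvg.
- exact: saddle_point_solution sp.
Qed.
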